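(* Let $n,m,c$ be positive integers and take $\mathcal{G}=\mathbb{Z}$. Extend the cycling operator to pairs by $C((g_0,\ldots,g_{n-1}),(w_0,\ldots,w_{n-1}))=((g_1,\ldots,g_{n-1},g_0-c),(w_1,\ldots,w_{n-1},w_0))$. Let $\mathrm{stat}$ be a function assigning a nonnegative integer to each pair $(g,w)$ with $g\in\mathrm{AV}_n$ and $w$ a rearrangement of $1,\ldots,n$, such that $\mathrm{stat}(C(g,w))=\mathrm{stat}(g,w)$ whenever both $(g,w)$ and $C(g,w)$ are such pairs. For $k\in\{0,\ldots,n-1\}$ let $P_k(t)=\sum_{f\in\mathrm{SKF}_k}t^{\mathrm{stat}(g(f),w(f))}$. Then $P_k(t)$ is independent of $k$ (and $P_k(1)=|\mathrm{SKF}_k|$).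
   Context: $[n]=\{1,\ldots,n\}$. An area vector is $g=(g_0,\ldots,g_{n-1})\in\mathbb{Z}^n$ with $g_{i+1}\leq g_i+m$ for $0\leq i<n-1$; $\mathrm{AV}_n$ is the set of area vectors. For $f:[n]\to\mathbb{Z}$, the label sequence $w(f)=(w_0,\ldots,w_{n-1})$ is the unique rearrangement of $1,\ldots,n$ such that $f(w_0)\leq\cdots\leq f(w_{n-1})$ and $w_i<w_{i+1}$ whenever $f(w_i)=f(w_{i+1})$; writing $x_i=f(w_i)$, the area vector of $f$ is $g(f)=(g_0,\ldots,g_{n-1})$ with $g_i=mi+c-x_i$. For $k\in\{0,\ldots,n-1\}$, $f$ is $k$-skeletal iff (P0) $x_0\geq 0$; (P1) $x_i<mi+c$ for all $i\in\{n-k-1,\ldots,n-1\}$; (P2) for every $i\in\{0,\ldots,n-k-1\}$ there is $j\in\{i,\ldots,i+k\}$ with $x_j\geq mj$. $\mathrm{SKF}_k$ is the set of $k$-skeletal functions $[n]\to\mathbb{Z}$. *)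

(* Defs.v *)
From HB Require Import structures.
From mathcomp Require Export all_boot all_order all_algebra.
From mathcomp Require Export finmap.
From mathcomp Require Export boolp classical_sets functions cardinality fsbigop.

Set Implicit Arguments.
Unset Strict Implicit.
Unset Printing Implicit Defensive.

Import Order.TTheory GRing.Theory Num.Theory.
Local Open Scope ring_scope.

(* The label set [n] = {1, ..., n} is rendered as 'I_n = {0, ..., n-1}; only
   the order of the labels is used. *)

Definition area_vector (n m : nat) (g : seq int) : Prop :=
  size g = n /\ forall i : nat, (i.+1 < n)%N -> g`_i.+1 <= g`_i + m%:Z.

Definition area_pair (n m : nat) (p : seq int * seq 'I_n) : Prop :=
  area_vector n m p.1 /\ perm_eq p.2 (enum 'I_n).

Definition cycling (n c : nat) (p : seq int * seq 'I_n) :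
    seq int * seq 'I_n :=
  (rcons (behead p.1) (head 0 p.1 - c%:Z), rot 1 p.2).

Section Functions.
Variable n : nat.
Implicit Types (f : {ffun 'I_n -> int}) (a b : 'I_n).

Definition label_le f : rel 'I_n :=
  fun a b => (f a <= f b) && ((f a == f b) ==> (a <= b)%N).

Definition label_lt f : rel 'I_n :=
  fun a b => (f a <= f b) && ((f a == f b) ==> (a < b)%N).

Definition labels f : seq 'I_n := sort (label_le f) (enum 'I_n).

Definition levels f : seq int := [seq f a | a <- labels f].

Definition area (m c : nat) f : seq int :=
  mkseq (fun i => (m * i + c)%:Z - (levels f)`_i) n.

Definition skeletal (m c k : nat) f : Prop :=
  [/\ 0 <= (levels f)`_0,
      forall i : nat, (n - k - 1 <= i <= n - 1)%N ->
        (levels f)`_i < (m * i + c)%:Z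
    & forall i : nat, (i <= n - k - 1)%N ->
        exists2 j : nat, (i <= j <= i + k)%N & (m * j)%:Z <= (levels f)`_j].

Lemma label_le_total f : total (label_le f).
Proof.
by move=> a b; rewrite /label_le; case: (ltgtP (f a) (f b)) => //= _; exact: leq_total.
Qed.

Lemma label_le_trans f : transitive (label_le f).
Proof.
move=> b a d; rewrite /label_le => /andP[ab tab] /andP[bd tbd]; rewrite (le_trans ab bd) /=.
apply/implyP => /eqP ad; have e : f a = f b by apply/le_anti; rewrite ab ad bd.
move: tab tbd; rewrite -ad e eqxx /=; exact: leq_trans.
Qed.

Lemma label_le_anti f : antisymmetric (label_le f).
Proof.
move=> a b; rewrite /label_le => /andP[/andP[ab tab] /andP[ba tba]].
have e : f a = f b by apply/le_anti; rewrite ab ba.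
by move: tab tba; rewrite e eqxx /= => h1 h2; apply/val_inj/anti_leq; rewrite h1.
Qed.

Lemma perm_labels f : perm_eq (labels f) (enum 'I_n).
Proof. by rewrite /labels perm_sort. Qed.

Lemma size_labels f : size (labels f) = n.
Proof. by rewrite (perm_size (perm_labels f)) size_enum_ord. Qed.

Lemma label_leE f a b : label_le f a b = label_lt f a b || (a == b).
Proof.
rewrite /label_le /label_lt; case: ltgtP => //= fab; last by rewrite orbC leq_eqVlt.
by case: eqP => // e; rewrite e ltxx in fab.
Qed.

(* [labels f] is the unique rearrangement w of the labels such that f is weakly
   increasing along w, with ties broken by increasing label. *)
Lemma labelsP f (w : seq 'I_n) :
  perm_eq w (enum 'I_n) /\ sorted (label_lt f) w <-> w = labels f.
Proof.
split=> [[pw sw]|->].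
  apply: (sorted_eq (@label_le_trans f) (@label_le_anti f)).
  - by apply: sub_sorted sw => a b ab; rewrite label_leE ab.
  - exact/sort_sorted/label_le_total.
  - by rewrite (permPl pw) perm_sym perm_labels.
split; first exact: perm_labels.
have := sort_sorted (@label_le_total f) (enum 'I_n); rewrite -/(labels f).
have : uniq (labels f) by rewrite (perm_uniq (perm_labels f)) enum_uniq.
elim: (labels f) => //= a [|b s] //= IH /andP[an us] /andP[ab ps].
rewrite (IH us ps) andbT.
move: ab; rewrite label_leE => /orP[//|].
by move=> /eqP e; rewrite e inE eqxx in an.
Qed.

Lemma size_levels f : size (levels f) = n.
Proof. by rewrite size_map size_labels. Qed.

Lemma levels_sorted f : sorted <=%R (levels f).
Proof.
rewrite sorted_map; apply: sub_sorted (sort_sorted (@label_le_total f) _).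
by move=> a b /andP[].
Qed.

Lemma levels_le f (i j : nat) :
  (i <= j < n)%N -> (levels f)`_i <= (levels f)`_j.
Proof.
move=> /andP[ij jn].
apply: (sorted_leq_nth le_trans lexx 0 (levels_sorted f)) => //;
  by rewrite inE size_levels ?(leq_ltn_trans ij).
Qed.

Lemma area_pairP (m c : nat) f : area_pair m (area m c f, labels f).
Proof.
split; last exact: perm_labels.
split=> [|i iN]; first by rewrite size_mkseq.
rewrite !nth_mkseq ?(ltnW iN) //.
have := @levels_le f i i.+1; rewrite leqnSn iN => /(_ isT) h.
rewrite mulnS -addnA PoszD [_ + m%:Z]addrC -addrA lerD2l lerD2l lerN2 //.
Qed.

End Functions.

Local Open Scope classical_set_scope.

Definition SKF (n m c k : nat) : set {ffun 'I_n -> int} :=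
  [set f | skeletal m c k f].
Arguments SKF : clear implicits.

Lemma finite_SKF (n m c k : nat) : finite_set (SKF n m c k).
Proof.
case: n => [|n].
  apply: (@sub_finite_set _ _ [set [ffun _ => 0]]); last exact: finite_set1.
  by move=> f _; apply/ffunP => -[].
pose h (u : {ffun 'I_n.+1 -> 'I_(m * n + c)}) : {ffun 'I_n.+1 -> int} :=
  [ffun a => (u a)%:Z].
apply: (@sub_finite_set _ _ (h @` setT)); last first.
  exact/finite_image/finite_finset.
move=> f [/= P0 P1 _].
have bnd a : 0 <= f a < (m * n + c)%:Z.
  have ain : a \in labels f by rewrite (perm_mem (perm_labels f)) mem_enum.
  have idx : (index a (labels f) < n.+1)%N.
    by rewrite -[X in (_ < X)%N](size_labels f) index_mem.
  have e : f a = (levels f)`_(index a (labels f)).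
    by rewrite (nth_map a) ?nth_index // index_mem.
  rewrite e (le_trans P0) ?levels_le //=.
  apply: (@le_lt_trans _ _ (levels f)`_n); first by rewrite levels_le // -ltnS idx /=.
  by apply: P1; rewrite -subnDA addn1 subSS leq_subr subn1 /=.
have lt a : (`|f a|%N < m * n + c)%N.
  by have /andP[f0 fN] := bnd a; rewrite -ltz_nat gez0_abs.
exists [ffun a => Ordinal (lt a)] => //.
by apply/ffunP => a; rewrite !ffunE /= gez0_abs //; have /andP[] := bnd a.
Qed.

(* [\sum_(f \in A) _] is the finite-support sum, which is the genuine sum here
   by [finite_SKF]; 'X is the variable t. *)
Definition skeletal_poly (n m c : nat) (stat : seq int * seq 'I_n -> nat)
    (k : nat) : {poly int} :=
  \sum_(f \in SKF n m c k) ('X^(stat (area m c f, labels f)) : {poly int}).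

(* Main.v *)
(** Put y_i = x_i - m i and extend y by y_(i+n) = y_i + c.  Cycling the pair
    (g(f), w(f)) amounts to adding mn + c to f at its first label and
    subtracting m everywhere, which shifts y by one index.  In terms of y, the
    function f is k-skeletal iff index 0 immediately follows the last run of
    k + 1 consecutive negative entries of y.  As y tends to -oo on the left and
    to +oo on the right, each cycling class contains exactly one k-skeletal
    function, for every k. *)

Require Import Defs.
From mathcomp Require Import all_boot all_order all_algebra.
From mathcomp Require Import finmap.
From mathcomp Require Import boolp classical_sets functions cardinality fsbigop.
From mathcomp Require Import zify.

Set Implicit Arguments.
Unset Strict Implicit.
Unset Printing Implicit Defensive.

Import Order.TTheory GRing.Theory Num.Theory.

Local Open Scope ring_scope.

(** * Rotation of functions and its effect on labels *)

Section Rotation.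
Variables n m c : nat.
Hypothesis c_gt0 : (0 < c)%N.

Local Notation N := n.+1.
Local Notation D := (m * N + c)%N.
Implicit Types (f h : {ffun 'I_N -> int}) (a b : 'I_N).

(* Says that the extension x_(i+n) = x_i + mn + c, w_(i+n) = w_i of the sorted
   values and labels is still sorted, ties included. *)
Definition balanced f : Prop :=
  forall a b, f a <= f b + D%:Z /\ (f a = f b + D%:Z -> (a < b)%N).

Definition first_label f : 'I_N := head ord0 (labels f).

Definition rotate f : {ffun 'I_N -> int} :=
  [ffun a => f a - m%:Z + (if a == first_label f then D%:Z else 0)].

(* The sequence y of the header, restricted to nonnegative indices. *)
Definition height f (i : nat) : int :=
  (levels f)`_(i %% N) - (m * (i %% N))%:Z + (c * (i %/ N))%:Z.

Lemma labels_cons f : labels f = first_label f :: behead (labels f).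
Proof. by rewrite /first_label; have := size_labels f; case: (labels f). Qed.

Lemma label_lt_trans f : transitive (label_lt f).
Proof.
by move=> b a d /andP[h1 /implyP h2] /andP[h3 /implyP h4]; apply/andP; split;
  [lia | apply/implyP; lia].
Qed.

Lemma labels_cons_pairwise f :
  all (label_lt f (first_label f)) (behead (labels f)) &&
  pairwise (label_lt f) (behead (labels f)).
Proof.
have [_] := (labelsP f (labels f)).2 erefl.
by rewrite (sorted_pairwise (@label_lt_trans f)) labels_cons.
Qed.

Lemma first_labelP f a : a != first_label f -> label_lt f (first_label f) a.
Proof.
move=> neq; have /andP[/allP + _] := labels_cons_pairwise f; apply.
have : a \in labels f by rewrite (perm_mem (perm_labels f)) mem_enum.
by rewrite labels_cons inE (negPf neq).
Qed.

Lemma first_label_notin f : first_label f \notin behead (labels f).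
Proof.
have : uniq (labels f) by rewrite (perm_uniq (perm_labels f)) enum_uniq.
by rewrite labels_cons => /andP[].
Qed.

Lemma rotate_first f : rotate f (first_label f) = f (first_label f) - m%:Z + D%:Z.
Proof. by rewrite ffunE eqxx. Qed.

Lemma rotate_other f a : a != first_label f -> rotate f a = f a - m%:Z.
Proof. by move=> /negPf neq; rewrite ffunE neq addr0. Qed.

(** The critical case has [a] the first label and [b] another: [D] cancels, and minimality of the
    first label, ties included, is what remains. *)
Lemma rotate_balanced f : balanced f -> balanced (rotate f).
Proof.
move=> bf a b; have := bf a b.
have [->|na] := eqVneq a (first_label f); have [->|nb] := eqVneq b (first_label f);
  rewrite ?rotate_first ?rotate_other //.
- by split; lia.
- by have /andP[h1 /implyP h2] := first_labelP nb; split; lia.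
- by split; lia.
- by move=> [h1 h2]; split; lia.
Qed.

Lemma iter_rotate_balanced f s : balanced f -> balanced (iter s rotate f).
Proof. by move=> bf; elim: s => //= s; exact: rotate_balanced. Qed.

(** Balancedness at [b := first_label f] puts the raised first label after all others, which keep
    their relative order. *)
Lemma labels_rotate f : balanced f -> labels (rotate f) = rot 1 (labels f).
Proof.
move=> bf; symmetry; apply/labelsP; split; first by rewrite perm_rot perm_labels.
rewrite (sorted_pairwise (@label_lt_trans _)) labels_cons rot1_cons pairwise_rcons.
have neq a : a \in behead (labels f) -> a != first_label f.
  by apply: contraTneq => ->; exact: first_label_notin.
have /andP[_ pw] := labels_cons_pairwise f; apply/andP; split.
  apply/allP => a /neq na; rewrite /label_lt rotate_first rotate_other //.
  by have [h1 h2] := bf a (first_label f); apply/andP; split; [lia | apply/implyP; lia].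
move: neq pw; elim: (behead (labels f)) => //= a s IH neq /andP[/allP pa ps].
rewrite IH // ?andbT; last by move=> b bs; apply: neq; rewrite inE bs orbT.
apply/allP => b bs; have := pa b bs; rewrite /label_lt.
rewrite !rotate_other ?neq ?inE ?eqxx ?bs ?orbT //.
by move=> /andP[h1 /implyP h2]; apply/andP; split; [lia | apply/implyP; lia].
Qed.

Lemma levels_rotate f : balanced f ->
  levels (rotate f) =
  rcons [seq x - m%:Z | x <- behead (levels f)] ((levels f)`_0 - m%:Z + D%:Z).
Proof.
move=> bf; rewrite /levels labels_rotate // labels_cons rot1_cons map_rcons /=.
rewrite rotate_first; congr rcons; rewrite -map_comp; apply/eq_in_map => a ain /=.
by rewrite rotate_other //; apply: contraTneq ain => ->; exact: first_label_notin.
Qed.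

(** * Heights: periodicity and shift under rotation *)

Lemma height_small f i : (i < N)%N -> height f i = (levels f)`_i - (m * i)%:Z.
Proof. by move=> iN; rewrite /height modn_small // divn_small // muln0 addr0. Qed.

Lemma height_periodic f i : height f (i + N) = height f i + c%:Z.
Proof. by rewrite /height modnDr divnDr // divnn /= addn1 mulnSr PoszD addrA. Qed.

Lemma height_N f : height f N = height f 0 + c%:Z.
Proof. exact: height_periodic f 0. Qed.

Lemma height_rotate f i : balanced f -> height (rotate f) i = height f i.+1.
Proof.
move=> bf.
suff small j : (j < N)%N -> height (rotate f) j = height f j.+1.
  elim/ltn_ind: i => i IH; case: (ltnP i N) => [/small //|iN].
  by rewrite -(subnK iN) -addSn !height_periodic IH //; lia.
(* At the last index [n] the raised level contributes [x_0 - m + D - m * n = x_0 + c], the height at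
   [N]. *)
move=> jN; rewrite height_small // levels_rotate // nth_rcons size_map size_behead.
rewrite size_levels /=; case: ltngtP => [jn|?|->]; last 1 first.
- by rewrite height_N height_small // muln0; set x := _`_0; lia.
- rewrite height_small // (nth_map 0) ?size_behead ?size_levels //.
  by rewrite nth_behead; lia.
- lia.
Qed.

Lemma height_iter_rotate f s i :
  balanced f -> height (iter s rotate f) i = height f (s + i).
Proof.
move=> bf; elim: s i => //= s IH i.
by rewrite height_rotate ?IH ?addnS //; exact: iter_rotate_balanced.
Qed.

Lemma labels_iter_rotate f s : balanced f -> (s <= N)%N ->
  labels (iter s rotate f) = rot s (labels f).
Proof.
move=> bf; elim: s => [|s IH] sN; first by rewrite rot0.
rewrite /= labels_rotate; last exact: iter_rotate_balanced.
by rewrite (IH (ltnW sN)) -rotD ?size_labels // add1n.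
Qed.

Lemma eq_labels_height f h :
  labels f = labels h -> height f =1 height h -> f = h.
Proof.
move=> el eh; apply/ffunP => a.
have aL : a \in labels f by rewrite (perm_mem (perm_labels f)) mem_enum.
have iN : (index a (labels f) < N)%N by rewrite -[ltnRHS](size_labels f) index_mem.
have := eh (index a (labels f)); rewrite !height_small // => /addIr.
by rewrite /levels -el !(nth_map a) ?index_mem // nth_index.
Qed.

(** * Full turns as translations *)

Definition translate (d : int) f : {ffun 'I_N -> int} := [ffun a => f a + d].

Lemma labels_translate d f : labels (translate d f) = labels f.
Proof.
rewrite /labels; congr sort; apply/funext => a; apply/funext => b.
by rewrite /label_le !ffunE lerD2r (inj_eq (addIr d)).
Qed.

Lemma height_translate d f i : height (translate d f) i = height f i + d.
Proof.
rewrite /height /levels labels_translate.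
have iN : (i %% N < size (labels f))%N by rewrite size_labels ltn_mod.
by rewrite !(nth_map ord0) // ffunE; lia.
Qed.

Lemma translate_balanced d f : balanced f -> balanced (translate d f).
Proof.
by move=> bf a b; rewrite !ffunE; have [h1 h2] := bf a b; split; lia.
Qed.

(** A full turn restores the labels and raises every height by [c]. *)
Lemma iter_rotate_period f : balanced f -> iter N rotate f = translate c%:Z f.
Proof.
move=> bf; apply: eq_labels_height => [|i].
  by rewrite labels_iter_rotate // labels_translate -[X in rot X](size_labels f) rot_size.
by rewrite height_iter_rotate // addnC height_periodic height_translate.
Qed.

Lemma iter_rotate_mul_period f q :
  balanced f -> iter (q * N) rotate f = translate (c * q)%:Z f.
Proof.
move=> bf; elim: q => [|q IH].
  by rewrite mul0n muln0; apply/ffunP => a; rewrite ffunE addr0.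
rewrite mulSn iterD IH iter_rotate_period; last exact: translate_balanced.
by apply/ffunP => a; rewrite !ffunE; lia.
Qed.

(** Some power of [rotate] is a translation, hence injective. *)
Lemma rotate_inj f h : balanced f -> balanced h -> rotate f = rotate h -> f = h.
Proof.
move=> bf bh e.
have : iter N rotate f = iter N rotate h by rewrite !iterSr e.
rewrite !iter_rotate_period // => /ffunP et; apply/ffunP => a.
by have := et a; rewrite !ffunE => /addIr.
Qed.

Lemma iter_rotate_inj f h s : balanced f -> balanced h ->
  iter s rotate f = iter s rotate h -> f = h.
Proof.
move=> bf bh; elim: s => //= s IH e; apply: IH; apply: rotate_inj e;
  exact: iter_rotate_balanced.
Qed.

(** * Rotation as cycling of pairs *)

Lemma area_height f : area m c f = mkseq (fun i => c%:Z - height f i) N.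
Proof.
apply: (@eq_from_nth _ 0); rewrite !size_mkseq // => i iN.
by rewrite !nth_mkseq // height_small //; lia.
Qed.

Lemma area_rotate f : balanced f ->
  (area m c (rotate f), labels (rotate f)) = cycling c (area m c f, labels f).
Proof.
move=> bf; rewrite /cycling labels_rotate //; congr pair.
rewrite !area_height /=; apply: (@eq_from_nth _ 0).
  by rewrite size_rcons /= !size_map !size_iota.
move=> i; rewrite size_map size_iota => iN.
rewrite nth_mkseq // height_rotate // nth_rcons size_map size_iota.
case: ltngtP => [ilt|?|->]; [|lia|by rewrite height_N; lia].
by rewrite (nth_map 0%N) ?size_iota // nth_iota.
Qed.

(** * Skeletal functions in a rotation orbit *)

Lemma skeletal_height k f : (k < N)%N ->
  skeletal m c k f <->
  [/\ 0 <= height f 0,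
      forall i : nat, (N - k - 1 <= i < N)%N -> height f i < c%:Z
    & forall i : nat, (i + k < N)%N ->
        exists2 j : nat, (i <= j <= i + k)%N & 0 <= height f j].
Proof.
move=> kN; split=> -[P0 P1 P2]; split.
- by rewrite height_small // muln0 subr0.
- by move=> i iN; rewrite height_small; [have := P1 i; lia | lia].
- move=> i iN; have [|j jI hj] := P2 i; first lia.
  by exists j => //; rewrite height_small; lia.
- by move: P0; rewrite height_small // muln0 subr0.
- by move=> i iN; have := P1 i; rewrite height_small; lia.
- move=> i iN; have [|j jI hj] := P2 i; first lia.
  by exists j => //; move: hj; rewrite height_small; lia.
Qed.

(** A window that crosses [N] contains [N], where the height is at least [c]; a window beyond [N] is
    moved back by one period. *)
Lemma skeletal_no_negative_run k f : (k < N)%N -> skeletal m c k f ->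
  forall i, exists2 j : nat, (i <= j <= i + k)%N & 0 <= height f j.
Proof.
move=> kN /(skeletal_height _ kN)[P0 _ P2]; elim/ltn_ind => i IH.
have [|ik] := ltnP (i + k) N; first exact: P2.
have [iN|Ni] := leqP i N.
  by exists N; rewrite ?iN ?height_N //; lia.
have [|j jI hj] := IH (i - N)%N; first lia.
by exists (j + N)%N; [lia | rewrite height_periodic; lia].
Qed.

(** (P0), and (P1) at the last index, confine all values to the interval from 0 to [m * n + c], so
    two of them differ by less than [D] and no tie arises. *)
Lemma skeletal_balanced k f : (k < N)%N -> skeletal m c k f -> balanced f.
Proof.
move=> kN [P0 P1 _] a b.
have level a' : f a' = (levels f)`_(index a' (labels f)) /\ (index a' (labels f) < N)%N.
  have aL : a' \in labels f by rewrite (perm_mem (perm_labels f)) mem_enum.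
  rewrite -[ltnRHS](size_labels f) index_mem; split=> //.
  by rewrite (nth_map a') ?index_mem // nth_index.
have [-> aN] := level a; have [-> bN] := level b.
have ha := @levels_le _ f (index a (labels f)) n.
have hb := @levels_le _ f 0 (index b (labels f)).
have := P1 n; split; nia.
Qed.

(** For [s > 0], (P1) of the rotated function, moved back one period, makes [f] negative at the
    [k + 1] indices before [s], as far as they are nonnegative. If [s <= k] they include 0, against
    (P0); otherwise they form a forbidden run. *)
Lemma skeletal_rotate_unique k f s : (k < N)%N ->
  skeletal m c k f -> skeletal m c k (iter s rotate f) -> s = 0%N.
Proof.
move=> kN sf ss; have bf := skeletal_balanced kN sf.
have /(skeletal_height _ kN)[P0 _ _] := sf.
have /(skeletal_height _ kN)[_ P1 _] := ss.
have neg i : (N - k - 1 <= i < N)%N -> (N <= s + i)%N -> height f (s + i - N) < 0.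
  by move=> /P1 + Ni; rewrite height_iter_rotate // -{1}(subnK Ni) height_periodic; lia.
apply/eqP; rewrite -leqn0 leqNgt; apply/negP => s0.
have [sk|ks] := leqP s k.
  by have := neg (N - s)%N; rewrite subnKC ?subnn; lia.
have [j jI hj] := skeletal_no_negative_run kN sf (s - k.+1).
by have := neg (j + N - s)%N; rewrite subnKC ?addnK; lia.
Qed.

(* Heights are compared with [c] rather than [0] because the run preceding the
   starting point may have negative indices; adding [n] to them adds [c]. *)
Lemma skeletal_rotate_exists_from k f : (k < N)%N -> balanced f ->
  (forall i, (i < N)%N -> height f i < c%:Z) ->
  exists s, skeletal m c k (iter s rotate f).
Proof.
move=> kN bf neg.
pose run (j : nat) : bool := `[< forall i, (j <= i <= j + k)%N -> height f i < c%:Z >].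
have exP : exists j, run j by exists (n - k)%N; apply/asboolP => i iI; apply: neg; lia.
(* Heights start at [- B] or above and gain [c >= 1] per period, so from period [B + 1] on they are
   at least [c]. This bounds the starts of runs, and a last run exists. *)
pose B := (\sum_(i < N) `|height f i|)%N.
have bnd i : (i < N)%N -> - B%:Z <= height f i.
  by move=> iN; rewrite /B (bigD1 (Ordinal iN)) //=; lia.
have big q i : (i < N)%N -> - B%:Z + (c * q)%:Z <= height f (i + q * N).
  move=> iN; elim: q => [|q IH]; first by rewrite addn0; have := bnd i iN; lia.
  by rewrite mulSnr addnA height_periodic; lia.
have ubP j : run j -> (j <= B.+1 * N)%N.
  move=> /asboolP /(_ j); rewrite leqnn leq_addr => /(_ isT) hj.
  rewrite leqNgt; apply/negP => jlt.
  have := big (j %/ N)%N (j %% N)%N (ltn_pmod _ (ltn0Sn n)).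
  rewrite addnC -divn_eq.
  have : (B.+1 <= j %/ N)%N by rewrite leq_divRL // ltnW.
  nia.
case: (ex_maxnP exP ubP) => j /asboolP runj maxj.
(* Ensures [N <= j + k.+1], so that the subtraction in the witness below is not truncated. *)
have jk : (n - k <= j)%N by apply: maxj; apply/asboolP => i iI; apply: neg; lia.
have after i : (j < i)%N -> exists2 i', (i <= i' <= i + k)%N & c%:Z <= height f i'.
  move=> ji; apply: contrapT => H.
  suff /maxj : run i by lia.
  by apply/asboolP => i' i'I; rewrite ltNge; apply/negP => h; apply: H; exists i'.
(* The window from [j + 1] has an entry at least [c], and all its indices but the last lie in the
   run at [j]. *)
have pos : c%:Z <= height f (j + k.+1).
  have [i iI hi] := after j.+1 (ltnSn j).
  have [e|ne] := eqVneq i (j + k.+1)%N; first by rewrite -e.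
  by have := runj i; lia.
exists (j + k.+1 - N)%N; apply/skeletal_height => //; split.
- by rewrite height_iter_rotate // addn0; move: pos; rewrite -{1}(@subnK N (j + k.+1));
    [rewrite height_periodic; lia | lia].
- by move=> i iI; rewrite height_iter_rotate //; apply: runj; lia.
- move=> i iI; have [|i' i'I hi'] := after (j + k.+1 + i)%N; first lia.
  exists (i' - (j + k.+1))%N; first lia.
  rewrite height_iter_rotate //.
  have e : i' = (j + k.+1 - N + (i' - (j + k.+1)) + N)%N by lia.
  by move: hi'; rewrite {1}e height_periodic; lia.
Qed.

(** * Rotation classes and their skeletal members *)

(** A common ancestor [h] stands in for negative powers of [rotate]. *)
Definition linked f f' : Prop :=
  exists h (a b : nat), [/\ balanced h, f = iter a rotate h & f' = iter b rotate h].

Lemma linked_sym f f' : linked f f' -> linked f' f.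
Proof. by move=> [h [a [b [bh e e']]]]; exists h, b, a. Qed.

(** Of the two ancestors of [f'], injectivity makes the nearer one an iterate of the farther one,
    which is then an ancestor of all three. *)
Lemma linked_trans f f' f'' : linked f f' -> linked f' f'' -> linked f f''.
Proof.
move=> [h [a [b [bh -> ->]]]] [h' [a' [b' [bh' e ->]]]].
have [ba|/ltnW ab] := leqP b a'.
  have -> : h = iter (a' - b) rotate h'.
    apply: (@iter_rotate_inj _ _ b) => //; first exact: iter_rotate_balanced.
    by rewrite e -iterD subnKC.
  by exists h', (a + (a' - b))%N, b'; rewrite iterD.
have -> : h' = iter (b - a') rotate h.
  apply: (@iter_rotate_inj _ _ a') => //; first exact: iter_rotate_balanced.
  by rewrite -e -iterD subnKC.
by exists h, a, (b' + (b - a'))%N; rewrite iterD.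
Qed.

Lemma linked_skeletal_eq k f f' : (k < N)%N ->
  skeletal m c k f -> skeletal m c k f' -> linked f f' -> f = f'.
Proof.
move=> kN sf sf' [h [a [b [bh e e']]]].
wlog ab : f f' a b sf sf' e e' / (a <= b)%N => [H|].
  have [ab|/ltnW ba] := leqP a b; first exact: (H f f' a b).
  by symmetry; exact: (H f' f b a).
have ef : f' = iter (b - a) rotate f by rewrite e e' -iterD subnK.
by rewrite ef in sf' *; rewrite (skeletal_rotate_unique kN sf sf').
Qed.

(* Translating [f] down by a multiple of [c] moves it backwards along its
   rotation class. *)
Lemma linked_skeletal_exists k f : (k < N)%N -> balanced f ->
  exists2 f', skeletal m c k f' & linked f f'.
Proof.
move=> kN bf.
pose B := (\sum_(i < N) `|height f i|)%N.
have bnd i : (i < N)%N -> height f i <= B%:Z.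
  by move=> iN; rewrite /B (bigD1 (Ordinal iN)) //=; lia.
(* As [c >= 1], the heights of [h] in the first period are at most [B - c * B <= 0 < c]. *)
pose h := translate (- (c * B)%:Z) f.
have bh : balanced h by exact: translate_balanced.
have [i iN|s hs] := @skeletal_rotate_exists_from k h kN bh.
  by rewrite height_translate; have := bnd i iN; nia.
exists (iter s rotate h) => //; exists h, (B * N)%N, s; split=> //.
by rewrite iter_rotate_mul_period //; apply/ffunP => a; rewrite !ffunE subrK.
Qed.

(** * Invariance of the statistic and the bijection *)

Lemma stat_iter_rotate (stat : seq int * seq 'I_N -> nat) f s :
  (forall p, area_pair m p -> area_pair m (cycling c p) ->
     stat (cycling c p) = stat p) ->
  balanced f ->
  stat (area m c (iter s rotate f), labels (iter s rotate f)) =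
  stat (area m c f, labels f).
Proof.
move=> hstat bf; elim: s => //= s <-.
have bs := iter_rotate_balanced s bf.
rewrite area_rotate // hstat //; first exact: area_pairP.
by rewrite -area_rotate //; exact: area_pairP.
Qed.

End Rotation.

Theorem theorem5p2 (n m c : nat) (hn : (0 < n)%N) (hm : (0 < m)%N)
    (hc : (0 < c)%N)
    (stat : seq int * seq 'I_n -> nat)
    (hstat : forall p : seq int * seq 'I_n,
       area_pair m p -> area_pair m (cycling c p) ->
       stat (cycling c p) = stat p) :
  (forall k l : 'I_n, skeletal_poly m c stat k = skeletal_poly m c stat l) /\
  (forall k : 'I_n,
     (skeletal_poly m c stat k).[1] = (#|` fset_set (SKF n m c k)|)%:R).
Proof.
split=> [k l|k]; last first.
  rewrite /skeletal_poly fsbig_finite; last exact: finite_SKF.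
  rewrite horner_sum card_fset_sum1 natr_sum; apply: eq_bigr => f _.
  by rewrite hornerXn expr1n.
case: n hn stat hstat k l => // n _ stat hstat k l.
(* [F] picks the [l]-skeletal member of the class of a [k]-skeletal function; elsewhere its value is
   arbitrary. *)
have /boolp.choice[F FP] : forall f : {ffun 'I_n.+1 -> int}, exists f',
    skeletal m c k f -> skeletal m c l f' /\ linked m c f f'.
  move=> f; have [sf|nf] := pselect (skeletal m c k f); last by exists f.
  have [f' sf' lf] :=
    linked_skeletal_exists hc (ltn_ord l) (skeletal_balanced hc (ltn_ord k) sf).
  by exists f'.
rewrite /skeletal_poly [RHS](@reindex_fsbig _ _ _ _ _ F (SKF n.+1 m c k)).
  apply: eq_fsbigr => f /set_mem /FP[_ [h [a [b [bh -> ->]]]]].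
  by rewrite !stat_iter_rotate.
(* Injectivity uses uniqueness of the [k]-skeletal member of a class, surjectivity its existence and
   the uniqueness of the [l]-skeletal one. *)
split=> [f /FP[]//|f f' /set_mem sf /set_mem sf' e|f' sf'].
  apply: (linked_skeletal_eq hc (ltn_ord k) sf sf').
  have [_ lf] := FP _ sf; have [_ lf'] := FP _ sf'.
  by rewrite e in lf; exact: linked_trans lf (linked_sym lf').
have [f sf lf] :=
  linked_skeletal_exists hc (ltn_ord k) (skeletal_balanced hc (ltn_ord l) sf').
exists f => //; have [sF lF] := FP _ sf.
apply: (linked_skeletal_eq hc (ltn_ord l) sF sf').
exact: linked_trans (linked_sym lF) (linked_sym lf).
Qed.
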